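(* Let $n\in\mathbb{N}$, let $H$ be a Hilbert space, let $C_n=\mathbb{Z}/n\mathbb{Z}$, and let $L=H\otimes\ell_2(C_n)=\ell_2(C_n,H)$. Let $\mathcal{A}=B(H)\otimes\ell_\infty(C_n)=\ell_\infty(C_n,B(H))$ act on $L$ as the diagonal operators in $M_{C_n}(B(H))$, with the action $\alpha_f(A)(g):=A(g-f)$ of $C_n$ on $\mathcal{A}$, implemented by the unitaries $(L_f\Xi)(g):=\Xi(g-f)$ on $L$ ($f,g\in C_n$, $A\in\mathcal{A}$, $\Xi\in L$). Then the C*-algebra $\mathcal{C}$ on $L$ generated by $\mathcal{A}$ and $\{L_g:g\in C_n\}$ is $M_{C_n}(B(H))=B(H)\otimes M_{C_n}(\mathbb{C})$, it is isomorphic to the reduced crossed product $\mathrm{C}^*_r(\mathcal{A},\alpha,C_n)$, the corresponding conditional expectation $\pi$ of $\mathcal{C}$ onto $\mathcal{A}$ is the diagonal projection $\pi(X)_{kl}=\delta(k,l)x_{kk}$ for $X=(x_{ij})$, and the Hadamard product on $\mathcal{C}$ is the block Schur product: for all $X=(x_{ij})$ and $Y=(y_{ij})$ in $\mathcal{C}$, written $X=\sum_{g\in C_n}L_gX_g$, $Y=\sum_{g\in C_n}L_gY_g$ with $X_g=\pi(L_g^*X)$ and $Y_g=\pi(L_g^*Y)$ diagonal, $$X\star Y=\sum_{g\in C_n}L_gX_gY_g=X\square Y=(x_{ij}y_{ij}).$$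
   Context: $\delta$ is the Kronecker delta. The block Schur product of two matrices $X=(x_{ij})$, $Y=(y_{ij})$ with entries in $B(H)$ is the entrywise product $X\square Y:=(x_{ij}y_{ij})$. For a C*-algebra $\mathcal{A}$ on a Hilbert space $M$ with an action $\alpha$ of a discrete group $G$ by *-automorphisms, the reduced crossed product $\mathrm{C}^*_r(\mathcal{A},\alpha,G)$ is the C*-algebra on $M\otimes\ell_2(G)$ generated by the operators $\Psi(A)=\sum_{g\in G}\alpha_g^{-1}(A)\otimes E_g$ ($A\in\mathcal{A}$, $E_g$ the rank one projection onto the $g$-th standard basis vector of $\ell_2(G)$) and $I\otimes l_g$ ($g\in G$, $l_g$ left translation on $\ell_2(G)$). It has a faithful conditional expectation onto $\Psi(\mathcal{A})$ which maps $(I\otimes l_g)\Psi(A)$ to $\delta(g,e)\Psi(A)$. In any faithful covariant representation of it with implementing unitaries $L_g$ and corresponding conditional expectation $\pi$ onto the copy of $\mathcal{A}$, with $\pi(L_gA)=\delta(g,e)A$, the coefficients of an element $X$ are $X_g:=\pi(L_g^*X)$. The Hadamard product $X\star Y$ is the product whose coefficients are $(X\star Y)_g=X_gY_g$, i.e. $X\star Y=\sum_gL_gX_gY_g$ (a finite sum when $G$ is finite). *)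

(* Defs.v *)
From HB Require Import structures.
From mathcomp Require Import all_boot all_order all_algebra.
From mathcomp Require Import all_classical all_reals all_analysis.
From mathcomp Require Import sesquilinear complex ring lra.

Set Implicit Arguments.
Unset Strict Implicit.
Unset Printing Implicit Defensive.

Import Order.TTheory GRing.Theory Num.Theory.
Import numFieldNormedType.Exports.

Local Open Scope classical_set_scope.
Local Open Scope complex_scope.
Local Open Scope ring_scope.

(* The inner product of a Hilbert space is linear in its first argument. *)
HB.mixin Record isHilbert (R : realType) H & CompleteNormedModule R[i] H := {
  hdot : {dot H for @Num.conj R[i]};
  hdot_norm : forall x : H, `|x| ^+ 2 = hdot x x
}.

#[short(type="hilbertType")]
HB.structure Definition Hilbert (R : realType) :=
  {H of CompleteNormedModule R[i] H & isHilbert R H}.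

Section DotTheory.
Variables (R : realType) (U : lmodType R[i]) (f : {dot U for @Num.conj R[i]}).

Lemma dotC u v : f u v = Num.conj (f v u).
Proof. by rewrite hermC expr0 mul1r. Qed.

Lemma dot_real u : Num.conj (f u u) = f u u.
Proof. by rewrite -dotC. Qed.

Lemma dotDl u v w : f (u + v) w = f u w + f v w.
Proof. exact: linearDl. Qed.

Lemma dotDr u v w : f w (u + v) = f w u + f w v.
Proof. exact: linearDr. Qed.

Lemma dotBl u v w : f (u - v) w = f u w - f v w.
Proof. exact: linearBl. Qed.

Lemma dotBr u v w : f w (u - v) = f w u - f w v.
Proof. exact: linearBr. Qed.

Lemma dotZl a u v : f (a *: u) v = a * f u v.
Proof. exact: linearZl_LR. Qed.

Lemma dotZr a u v : f u (a *: v) = Num.conj a * f u v.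
Proof. exact: linearZr_LR. Qed.

Lemma dot0l u : f 0 u = 0.
Proof. exact: linear0l. Qed.

Lemma dot0r u : f u 0 = 0.
Proof. exact: linear0r. Qed.

Lemma dot_suml (I : finType) (F : I -> U) u : f (\sum_i F i) u = \sum_i f (F i) u.
Proof. by apply: (big_morph (f^~ u)) => [x y|]; rewrite ?dotDl ?dot0l. Qed.

Lemma dot_sumr (I : finType) (F : I -> U) u : f u (\sum_i F i) = \sum_i f u (F i).
Proof. by apply: (big_morph (f u)) => [x y|]; rewrite ?dotDr ?dot0r. Qed.

Lemma dot_CauchySchwarz u v : `|f u v| ^+ 2 <= f u u * f v v.
Proof.
have [->|v0] := eqVneq v 0.
  by rewrite !dot0r mulr0 normr0 expr0n.
have fv0 : 0 < f v v by rewrite neq0_dnorm_gt0.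
pose w := f v v *: u - f u v *: v.
have : f w w = f v v * (f u u * f v v - `|f u v| ^+ 2).
  rewrite normCK /w dotBl !dotBr !dotZl !dotZr (dotC v u) dot_real; ring.
have := dnorm_ge0 f w => /[swap] ->.
by rewrite pmulr_rge0// subr_ge0.
Qed.

Lemma sqrt_dotD u v :
  sqrtC (f (u + v) (u + v)) <= sqrtC (f u u) + sqrtC (f v v).
Proof.
have h w : 0 <= f w w := dnorm_ge0 f w.
rewrite -(@ler_pXn2r _ 2%N)// ?nnegrE ?sqrtC_ge0 ?addr_ge0 ?sqrtC_ge0//.
rewrite sqrtCK sqrrD !sqrtCK dotDl !dotDr (dotC v u).
have fuv : f u v + Num.conj (f u v) <= (sqrtC (f u u) * sqrtC (f v v)) *+ 2.
  have -> : f u v + Num.conj (f u v) = 'Re (f u v) *+ 2.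
    by rewrite [in RHS]ReE -[RHS]mulr_natl mulrC divfK ?pnatr_eq0.
  rewrite lerMn2r/=; apply: (le_trans (leif_Re_Creal _)).
  rewrite -(@ler_pXn2r _ 2%N)// ?nnegrE ?mulr_ge0 ?sqrtC_ge0//.
  by rewrite exprMn !sqrtCK dot_CauchySchwarz.
rewrite -[leLHS]addrA [leRHS]addrAC -addrA lerD2l addrA.
by rewrite [leRHS]addrC lerD2r.
Qed.

Lemma sqrt_dotZ a u : sqrtC (f (a *: u) (a *: u)) = `|a| * sqrtC (f u u).
Proof.
rewrite dotZl dotZr mulrA -normCK sqrtCM ?nnegrE ?exprn_ge0 ?dnorm_ge0//.
by rewrite sqrCK.
Qed.

Lemma sqrt_dot_eq0 u : sqrtC (f u u) = 0 -> u = 0.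
Proof. by move=> /eqP; rewrite sqrtC_eq0 dnorm_eq0 => /eqP. Qed.

End DotTheory.

Section HilbertTheory.
Variables (R : realType) (H : hilbertType R).
Implicit Types x y : H.

Lemma norm_hdotE x : `|x| = sqrtC (hdot x x).
Proof. by rewrite -hdot_norm sqrCK. Qed.

Lemma hdot_le x y : `|hdot x y| <= `|x| * `|y|.
Proof.
rewrite -(@ler_pXn2r _ 2%N) ?nnegrE ?mulr_ge0//.
by rewrite exprMn !hdot_norm dot_CauchySchwarz.
Qed.

Lemma hdot_inj x y : (forall z, hdot z x = hdot z y) -> x = y.
Proof.
move=> xy; apply/eqP; rewrite -subr_eq0 -(dnorm_eq0 hdot) dotBr.
by rewrite xy subrr.
Qed.

End HilbertTheory.

(* The Hilbert space l_2(I, H) = H (x) l_2(I), for a finite index set I. *)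
Definition ell2 (R : realType) (I : finType) (H : hilbertType R) :=
  {ffun I -> H}.

Section Ell2.
Variables (R : realType) (I : finType) (H : hilbertType R).
Local Notation L := (ell2 I H).
Implicit Types f g : L.

HB.instance Definition _ := GRing.Lmodule.copy L {ffun I -> H}.

Definition ell2_dot f g : R[i] := \sum_i hdot (f i) (g i).

Fact ell2_dot_bilinear :
  bilinear_for
    (GRing.Scale.Law.clone _ _ ( *%R : R[i] -> R[i] -> R[i]) _)
    (GRing.Scale.Law.clone _ _ (@Num.conj R[i] \; *%R) _) ell2_dot.
Proof.
split=> [g|f] a u v; rewrite /ell2_dot /= mulr_sumr -big_split/=;
  apply: eq_bigr => i _; rewrite !ffunE.
- by rewrite dotDl dotZl.
- by rewrite dotDr dotZr.
Qed.

HB.instance Definition _ :=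
  bilinear_isBilinear.Build R[i] L L R[i] _ _ ell2_dot ell2_dot_bilinear.

Fact ell2_dot_hermitian f g :
  ell2_dot f g = (-1) ^+ false * Num.conj (ell2_dot g f).
Proof.
rewrite mul1r rmorph_sum; apply: eq_bigr => i _; exact: dotC.
Qed.

HB.instance Definition _ :=
  isHermitianSesquilinear.Build R[i] L false (@Num.conj R[i]) ell2_dot
    ell2_dot_hermitian.

Fact ell2_dot_gt0 f : f != 0 -> 0 < ell2_dot f f.
Proof.
move=> f0; rewrite lt_def sumr_ge0 ?andbT; last by move=> i _; exact: dnorm_ge0.
apply: contra f0; rewrite psumr_eq0; last by move=> i _; exact: dnorm_ge0.
move=> /allP f0; apply/eqP/ffunP => i; rewrite ffunE.
by apply/eqP; rewrite -(dnorm_eq0 hdot) (implyP (f0 i _))// mem_index_enum.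
Qed.

HB.instance Definition _ := isDotProduct.Build R[i] L ell2_dot ell2_dot_gt0.

Definition ell2_norm f := sqrtC (ell2_dot f f).

HB.instance Definition _ := Lmodule_isNormed.Build R[i] L
  (sqrt_dotD ell2_dot : forall f g, ell2_norm (f + g) <= ell2_norm f + ell2_norm g)
  (sqrt_dotZ ell2_dot) (@sqrt_dot_eq0 _ _ ell2_dot).

Fact ell2_normE f : `|f| ^+ 2 = ell2_dot f f.
Proof. exact: sqrtCK. Qed.

Fact ell2_norm_coord f i : `|f i| <= `|f|.
Proof.
rewrite -(@ler_pXn2r _ 2%N) ?nnegrE// ell2_normE hdot_norm.
by rewrite /ell2_dot (bigD1 i)//= lerDl sumr_ge0// => j _; exact: dnorm_ge0.
Qed.

Fact ell2_norm_sum f : `|f| <= \sum_i `|f i|.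
Proof.
rewrite -(@ler_pXn2r _ 2%N) ?nnegrE ?sumr_ge0//.
rewrite ell2_normE /ell2_dot expr2 mulr_suml; apply: ler_sum => i _.
rewrite -hdot_norm expr2 ler_wpM2l// (bigD1 i)//= lerDl sumr_ge0//.
Qed.

Fact ell2_cauchy_cvg (F : set_system L) : ProperFilter F -> cauchy F -> cvg F.
Proof.
move=> FF /cauchyP Fc.
have Fi i : cvg ((fun f : L => f i) @ F).
  apply: cauchy_cvg; apply/cauchyP => e e0.
  have [f] := Fc e e0; rewrite -ball_normE => Ff; exists (f i).
  suff : F [set g : L | ball (f i) e (g i)] by [].
  apply: filterS Ff => g; rewrite /= -ball_normE /ball_/=.
  by apply: le_lt_trans; have := ell2_norm_coord (f - g) i; rewrite !ffunE.
pose l : L := [ffun i => lim ((fun f : L => f i) @ F)].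
apply/cvg_ex; exists l; apply/cvgrPdist_lt => e e0.
pose N : R[i] := #|I|.+1%:R.
have eN : 0 < e / N by rewrite divr_gt0// ltr0n.
have : F [set f : L | forall i, `|l i - f i| < e / N].
  apply: (@filter_forall _ _ (fun i => [set f : L | `|l i - f i| < e / N])) => i.
  by rewrite ffunE; move/cvgrPdist_lt: (Fi i); apply.
apply: filterS => f fe; apply: (le_lt_trans (ell2_norm_sum _)).
have : \sum_i `|(l - f) i| <= \sum_(i : I) e / N.
  by apply: ler_sum => i _; move: (ltW (fe i)); rewrite !ffunE.
move=> /le_lt_trans; apply; rewrite sumr_const -mulr_natl mulrA mulrAC.
rewrite gtr_pMl// ltr_pdivrMr ?ltr0n// mul1r ltr_nat; exact: ltnSn.
Qed.

HB.instance Definition _ := Uniform_isComplete.Build L ell2_cauchy_cvg.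
HB.instance Definition _ := isHilbert.Build R L ell2_normE.

End Ell2.

(* bop H is B(H). *)
Record bop (R : realType) (H : hilbertType R) := Bop {
  bop_fun :> H -> H;
  bop_linear : linear bop_fun;
  bop_bounded : exists M : R[i], forall x, `|bop_fun x| <= M * `|x|
}.

Section BoundedOperators.
Variables (R : realType) (H : hilbertType R).
Implicit Types S T : bop H.

HB.instance Definition _ := gen_eqMixin (bop H).
HB.instance Definition _ := gen_choiceMixin (bop H).
HB.instance Definition _ T :=
  GRing.isLinear.Build R[i] H H *:%R (bop_fun T) (@bop_linear R H T).

Lemma bopP S T : S =1 T -> S = T.
Proof.
case: S T => [f fl fb] [g gl gb] /= /funext fg; rewrite fg in fl fb *.
by congr Bop; exact: Prop_irrelevance.
Qed.

Lemma bop_bound T : exists2 M : R[i], 0 <= M & forall x, `|T x| <= M * `|x|.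
Proof.
have [M TM] := bop_bounded T; exists `|M| => // x.
have [->|x0] := eqVneq x 0; first by rewrite linear0 normr0 mulr0.
rewrite ger0_norm// -(@pmulr_lge0 _ `|x|) ?normr_gt0//.
exact: le_trans (TM x).
Qed.

Fact bop0_linear : linear (fun _ : H => 0 : H).
Proof. by move=> a x y; rewrite scaler0 addr0. Qed.
Fact bop0_bounded : exists M : R[i], forall x : H, `|0 : H| <= M * `|x|.
Proof. by exists 0 => x; rewrite normr0 mul0r. Qed.
Definition bop0 := Bop bop0_linear bop0_bounded.

Fact bop1_linear : linear (@idfun H). Proof. by []. Qed.
Fact bop1_bounded : exists M : R[i], forall x : H, `|idfun x| <= M * `|x|.
Proof. by exists 1 => x; rewrite mul1r. Qed.
Definition bop1 := Bop bop1_linear bop1_bounded.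

Fact bop_opp_linear T : linear (fun x => - T x).
Proof. by move=> a x y; rewrite linearP opprD scalerN. Qed.
Fact bop_opp_bounded T : exists M : R[i], forall x, `|- T x| <= M * `|x|.
Proof. by have [M TM] := bop_bounded T; exists M => x; rewrite normrN. Qed.
Definition bop_opp T := Bop (bop_opp_linear T) (bop_opp_bounded T).

Fact bop_add_linear S T : linear (fun x => S x + T x).
Proof. by move=> a x y; rewrite !linearP scalerDr addrACA. Qed.
Fact bop_add_bounded S T : exists M : R[i], forall x, `|S x + T x| <= M * `|x|.
Proof.
have [M SM] := bop_bounded S; have [N TN] := bop_bounded T.
by exists (M + N) => x; rewrite mulrDl (le_trans (ler_normD _ _))// lerD.
Qed.
Definition bop_add S T := Bop (bop_add_linear S T) (bop_add_bounded S T).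

Fact bop_scale_linear a T : linear (fun x => a *: T x).
Proof. by move=> b x y; rewrite linearP scalerDr !scalerA mulrC. Qed.
Fact bop_scale_bounded a T : exists M : R[i], forall x, `|a *: T x| <= M * `|x|.
Proof.
have [M TM] := bop_bounded T; exists (`|a| * M) => x.
by rewrite normrZ -mulrA ler_wpM2l.
Qed.
Definition bop_scale a T := Bop (bop_scale_linear a T) (bop_scale_bounded a T).

Fact bop_mul_linear S T : linear (S \o T).
Proof. by move=> a x y /=; rewrite !linearP. Qed.
Fact bop_mul_bounded S T : exists M : R[i], forall x, `|(S \o T) x| <= M * `|x|.
Proof.
have [M M0 SM] := bop_bound S; have [N _ TN] := bop_bound T.
by exists (M * N) => x; rewrite -mulrA (le_trans (SM _))// ler_wpM2l.
Qed.
Definition bop_mul S T := Bop (bop_mul_linear S T) (bop_mul_bounded S T).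

Fact bop_addA : associative bop_add.
Proof. by move=> S T U; apply: bopP => x; exact: addrA. Qed.
Fact bop_addC : commutative bop_add.
Proof. by move=> S T; apply: bopP => x; exact: addrC. Qed.
Fact bop_add0 : left_id bop0 bop_add.
Proof. by move=> T; apply: bopP => x; exact: add0r. Qed.
Fact bop_addN : left_inverse bop0 bop_opp bop_add.
Proof. by move=> T; apply: bopP => x; exact: addNr. Qed.
HB.instance Definition _ :=
  GRing.isZmodule.Build (bop H) bop_addA bop_addC bop_add0 bop_addN.

Fact bop_mulA : associative bop_mul. Proof. by move=> S T U; exact: bopP. Qed.
Fact bop_mul1 : left_id bop1 bop_mul. Proof. by move=> T; exact: bopP. Qed.
Fact bop_mulr1 : right_id bop1 bop_mul. Proof. by move=> T; exact: bopP. Qed.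
Fact bop_mulDl : left_distributive bop_mul bop_add.
Proof. by move=> S T U; exact: bopP. Qed.
Fact bop_mulDr : right_distributive bop_mul bop_add.
Proof. by move=> S T U; apply: bopP => x; exact: linearD. Qed.
HB.instance Definition _ := GRing.Zmodule_isPzRing.Build (bop H)
  bop_mulA bop_mul1 bop_mulr1 bop_mulDl bop_mulDr.

Fact bop_scaleA a b T : bop_scale a (bop_scale b T) = bop_scale (a * b) T.
Proof. by apply: bopP => x; exact: scalerA. Qed.
Fact bop_scale1 : left_id 1 bop_scale.
Proof. by move=> T; apply: bopP => x; exact: scale1r. Qed.
Fact bop_scaleDr : right_distributive bop_scale +%R.
Proof. by move=> a S T; apply: bopP => x; exact: scalerDr. Qed.
Fact bop_scaleDl T : {morph bop_scale^~ T : a b / a + b}.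
Proof. by move=> a b; apply: bopP => x; exact: scalerDl. Qed.
HB.instance Definition _ := GRing.Zmodule_isLmodule.Build R[i] (bop H)
  bop_scaleA bop_scale1 bop_scaleDr bop_scaleDl.

(* The operator norm, as a supremum over the closed unit ball.  Norms of
   R[i]-modules take values in R[i], hence the cast. *)
Definition opnorm T : R[i] :=
  (sup [set complex.Re `|T x| | x in [set x : H | `|x| <= 1]])%:C.

Lemma normC_Re (V : normedModType R[i]) (v : V) : `|v| = (complex.Re `|v|)%:C.
Proof. by have /complex_realP[k ->] := normr_real v. Qed.

Lemma opnorm_ub T x : `|x| <= 1 -> `|T x| <= opnorm T.
Proof.
move=> x1; rewrite normC_Re lecR; apply: ub_le_sup; last by exists x.
have [M M0 TM] := bop_bound T; exists (complex.Re M) => _ [y /= y1 <-].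
have : `|T y| <= M by rewrite (le_trans (TM y))// ler_piMr.
by rewrite lecE => /andP[].
Qed.

Lemma opnorm_lub T M : (forall x, `|x| <= 1 -> `|T x| <= M) -> opnorm T <= M.
Proof.
move=> TM; have M0 : 0 <= M.
  by rewrite (le_trans _ (TM 0 _))// normr0.
have /complex_realP[m Mm] := ger0_real M0; rewrite Mm lecR.
apply: ge_sup; first by exists (complex.Re `|T 0|), 0 => //=; rewrite normr0.
by move=> _ [x /= x1 <-]; have := TM x x1; rewrite Mm normC_Re lecR.
Qed.

Lemma opnorm_ge0 T : 0 <= opnorm T.
Proof. by rewrite (le_trans _ (@opnorm_ub T 0 _))// normr0. Qed.

Lemma opnorm_le T x : `|T x| <= opnorm T * `|x|.
Proof.
have [->|x0] := eqVneq x 0; first by rewrite linear0 !normr0 mulr0.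
have nx : 0 < `|x| by rewrite normr_gt0.
rewrite -ler_pdivrMr// mulrC -{1}(normr_id x) -normfV -normrZ -linearZ.
by apply: opnorm_ub; rewrite normrZ normfV normr_id mulVf ?gt_eqF.
Qed.

Fact opnormD S T : opnorm (S + T) <= opnorm S + opnorm T.
Proof.
apply: opnorm_lub => x x1; rewrite (le_trans (ler_normD _ _))//.
by rewrite lerD// opnorm_ub.
Qed.

Fact opnormZ a T : opnorm (a *: T) = `|a| * opnorm T.
Proof.
have le b S : opnorm (b *: S) <= `|b| * opnorm S.
  by apply: opnorm_lub => x x1; rewrite normrZ ler_wpM2l// opnorm_ub.
apply/le_anti; rewrite le/=; have [->|a0] := eqVneq a 0.
  by rewrite normr0 mul0r opnorm_ge0.
rewrite -ler_pdivlMl ?normr_gt0// -normfV.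
by have := le a^-1 (a *: T); rewrite scalerA mulVf// scale1r.
Qed.

Fact opnorm_eq0 T : opnorm T = 0 -> T = 0.
Proof.
move=> T0; apply: bopP => x; apply/eqP; rewrite -normr_le0.
by have := opnorm_le T x; rewrite T0 mul0r.
Qed.

HB.instance Definition _ :=
  Lmodule_isNormed.Build R[i] (bop H) opnormD opnormZ opnorm_eq0.

End BoundedOperators.

Section Riesz.
Variables (R : realType) (H : hilbertType R) (phi : H -> R[i]) (M : R[i]).
Hypothesis phiD : forall x y, phi (x + y) = phi x + phi y.
Hypothesis phiZ : forall a x, phi (a *: x) = a * phi x.
Hypothesis phiM : forall x, `|phi x| <= M * `|x|.

Let J x := hdot x x - (phi x + Num.conj (phi x)).
Let j x := complex.Re (J x).
Let D x w := hdot w x - phi w.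

Let JE x : J x = (j x)%:C.
Proof.
have /CrealP/complex_realP[k Jk] : Num.conj (J x) = J x.
  by rewrite /J rmorphB rmorphD/= conjCK dot_real (addrC (Num.conj _)).
by rewrite /j Jk.
Qed.

Let JD x w : J (x + w) = J x + `|w| ^+ 2 + (D x w + Num.conj (D x w)).
Proof.
rewrite hdot_norm /J /D phiD dotDl !dotDr (dotC _ x w) !rmorphD/= rmorphN/=.
ring.
Qed.

Let Re2_le (d : R[i]) : - (d + Num.conj d) <= `|d| *+ 2.
Proof.
rewrite (le_trans (real_ler_norm _))//.
  by rewrite rpredN; apply/CrealP; rewrite rmorphD/= conjCK addrC.
by rewrite normrN (le_trans (ler_normD _ _))// norm_conjC mulr2n.
Qed.

Let M0 : exists2 N : R[i], 0 <= N & forall x, `|phi x| <= N * `|x|.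
Proof.
exists `|M| => // x; have [->|x0] := eqVneq x 0.
  by rewrite -[in phi _](scale0r (0 : H)) phiZ mul0r !normr0 mulr0.
rewrite (@ger0_norm _ M)// -(@pmulr_lge0 _ `|x|) ?normr_gt0//.
exact: le_trans (phiM x).
Qed.

Let j_lb : has_lbound (range j).
Proof.
have [N N0 phiN] := M0; have /complex_realP[n nE] := ger0_real N0.
exists (- n ^+ 2) => _ [x _ <-]; suff : - N ^+ 2 <= J x.
  by rewrite JE nE -rmorphXn -rmorphN lecR.
rewrite -subr_ge0 opprK /J -hdot_norm.
set q := phi x + _.
have -> : `|x| ^+ 2 - q + N ^+ 2 = (`|x| - N) ^+ 2 + (N * `|x| *+ 2 - q) by ring.
have qle : q <= `|phi x| *+ 2.
  by have := Re2_le (- phi x); rewrite normrN rmorphN/= -opprD opprK.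
apply: addr_ge0; first by rewrite -realEsqr realB ?ger0_real.
by rewrite subr_ge0 (le_trans qle)// lerMn2r phiN.
Qed.

Let m := inf (range j).

Let mJ x : m%:C <= J x.
Proof. by rewrite JE lecR; apply: ge_inf => //; exists x. Qed.

Let S (e : R) := [set x | j x < m + e].
Let F := filter_from [set e | 0 < e] S.

Let F_proper : ProperFilter F.
Proof.
apply: filter_from_proper; last first.
  move=> e /= e0.
  have hj : has_inf (range j) by split=> //; exists (j 0), 0.
  by have [_ [x _ <-] xe] := inf_adherent e0 hj; exists x.
apply: filter_from_filter; first by exists 1 => /=.
move=> d e d0 e0; exists (Num.min d e); first by rewrite /= lt_min d0.
by move=> x; rewrite /S/= -ltrBlDl lt_min !ltrBlDl => /andP[].
Qed.

Let S_close e x y : S e x -> S e y -> `|x - y| ^+ 2 <= (4 * e)%:C.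
Proof.
rewrite /S /= -!ltcR rmorphD/= -!JE => Sx Sy.
pose c := 2^-1 *: (x + y); pose w := 2^-1 *: (x - y).
have half (u v : H) : 2^-1 *: (u + v) + 2^-1 *: (u - v) = u.
  rewrite -scalerDr addrACA subrr addr0 -mulr2n -(scaler_nat _ u) scalerA.
  by rewrite mulVf ?scale1r// pnatr_eq0.
have cx : x = c + w by rewrite half.
have cy : y = c + - w by rewrite -scalerN opprB /c (addrC x) half.
have w2 : `|x - y| ^+ 2 = 4 * `|w| ^+ 2.
  rewrite normrZ exprMn normfV normr_nat; by field.
have := mJ c; have := JD c w; have := JD c (- w).
have -> : D c (- w) = - D c w.
  rewrite /D -scaleN1r phiZ dotZl; ring.
rewrite -cx -cy normrN w2 rmorphN/= => Jy Jx mc.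
have -> : 4 * `|w| ^+ 2 = (J x + J y) *+ 2 - J c *+ 4 by rewrite Jx Jy; ring.
move: Sx Sy mc; rewrite !JE -!rmorphD/= !ltcR lecR => Sx Sy mc.
rewrite -!rmorphMn -rmorphB/= lecR; lra.
Qed.

Let F_cauchy : cauchy F.
Proof.
apply: (@cauchy_exP _ _ F (@filter_filter _ _ F_proper)) => e e0.
have /complex_realP[r er] := gtr0_real e0.
have r0 : 0 < r by rewrite -ltcR -er.
have d0 : 0 < r ^+ 2 / 8 by rewrite divr_gt0 ?exprn_gt0.
have Fd : F (S (r ^+ 2 / 8)) by exists (r ^+ 2 / 8).
have [x Sx] := @filter_ex _ _ F_proper _ Fd.
exists x, (r ^+ 2 / 8) => // y Sy; rewrite -ball_normE /=.
rewrite -(@ltr_pXn2r _ 2%N) ?nnegrE ?(ltW e0)//.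
rewrite (le_lt_trans (S_close Sx Sy))// er -rmorphXn ltcR.
have := exprn_gt0 2 r0; lra.
Qed.

Lemma riesz : exists z, forall x, phi x = hdot x z.
Proof.
have /cvg_ex[z Fz] : cvg F by exact: (@cauchy_cvg H F F_proper F_cauchy).
exists z => w.
have [N N0 phiN] := M0.
have Dle x v : `|D x v| <= `|v| * (`|x| + N).
  rewrite mulrDr (le_trans (ler_normB _ _))// lerD ?hdot_le//.
  by rewrite mulrC phiN.
pose K := complex.Re (`|z| + N).
have KE : `|z| + N = K%:C.
  by have /complex_realP[k] := ger0_real (addr_ge0 (normr_ge0 z) N0); rewrite /K => ->.
have K0 : 0 <= K by rewrite -lecR -KE addr_ge0.
have Jz : J z = m%:C.
  apply/le_anti; rewrite mJ andbT JE lecR; apply/ler_addgt0Pr => e e0.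
  pose d := e / (1 + K *+ 2).
  have K1 : 0 < 1 + K *+ 2 by rewrite ltr_pwDl// mulrn_wge0.
  have d0 : 0 < d by rewrite divr_gt0.
  have d0' : 0 < d%:C by rewrite ltcR.
  have Fd : F (S d) by exists d.
  have Fb : F (ball z d%:C) by apply: Fz; exact: nbhsx_ballx.
  have [x [Sx]] := @filter_ex _ _ F_proper _ 
    (@filterI _ _ (@filter_filter _ _ F_proper) _ _ Fd Fb).
  rewrite -ball_normE /= distrC => xz.
  have xE : x = z + (x - z) by rewrite addrC subrK.
  have : J z <= J x + `|D z (x - z)| *+ 2.
    have := JD z (x - z); rewrite -xE => ->; set q := D z _; rewrite -subr_ge0.
    have -> : J z + `|x - z| ^+ 2 + (q + Num.conj q) + `|q| *+ 2 - J z =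
      `|x - z| ^+ 2 + (`|q| *+ 2 - (- (q + Num.conj q))) by ring.
    by rewrite addr_ge0// subr_ge0.
  have qd : `|D z (x - z)| <= d%:C * K%:C.
    rewrite (le_trans (Dle _ _))// KE ler_wpM2r ?lecR//.
    exact: ltW.
  have -> : e = d * (1 + K *+ 2) by rewrite divfK ?gt_eqF.
  have : J x + `|D z (x - z)| *+ 2 <= J x + (d * K *+ 2)%:C.
    by rewrite lerD2l rmorphMn/= lerMn2r/= rmorphM.
  move=> /[swap] /le_trans /[apply].
  rewrite !JE -rmorphD lecR; rewrite /S/= in Sx; lra.
apply/eqP; rewrite eq_sym -subr_eq0; apply/negPn/negP => q0.
rewrite -/(D z w) in q0; set q := D z w in q0.
pose s : R[i] := (`|w| ^+ 2 + 1)^-1.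
have s0 : 0 < s by rewrite invr_gt0 ltr_wpDl.
have : J z <= J (z + (- s * Num.conj q) *: w) by rewrite Jz mJ.
have sC : Num.conj s = s by apply/CrealP; rewrite ger0_real// ltW.
have DZ a : D z (a *: w) = a * q by rewrite /q /D phiZ dotZl; ring.
rewrite JD DZ -addrA lerDl normrZ.
have -> : (`|- s * Num.conj q| * `|w|) ^+ 2
    + (- s * Num.conj q * q + Num.conj (- s * Num.conj q * q)) =
    - (s * `|q| ^+ 2 * (2 - s * `|w| ^+ 2)).
  rewrite !rmorphM/= rmorphN/= conjCK sC normrM normrN (gtr0_norm s0).
  by rewrite norm_conjC !exprMn [in LHS]normCK [in RHS]normCK; ring.
have sq : 0 < s * `|q| ^+ 2 by rewrite mulr_gt0// exprn_gt0// normr_gt0.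
have sw : s * `|w| ^+ 2 < 1.
  by rewrite mulrC ltr_pdivrMr ?mul1r ?ltrDl// ltr_wpDl.
rewrite oppr_ge0 pmulr_rle0// subr_le0 => /le_lt_trans/(_ sw).
by rewrite (ltr_nat _ 2 1).
Qed.
End Riesz.

Section Adjoint.
Variables (R : realType) (H : hilbertType R).
Implicit Types S T : bop H.

Lemma adjoint_exists T : exists S, forall x y, hdot (T x) y = hdot x (S y).
Proof.
have /choice[S TS] y : exists z, forall x, hdot (T x) y = hdot x z.
  apply: (@riesz _ _ _ (opnorm T * `|y|)) => [u v|a u|u].
  - by rewrite linearD dotDl.
  - by rewrite linearZ dotZl.
  - rewrite (le_trans (hdot_le _ _))// mulrAC ler_wpM2r//; exact: opnorm_le.
have Slin : linear S.
  move=> a x y; apply: hdot_inj => z.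
  by rewrite -TS !dotDr !dotZr !TS.
have Sbnd : exists M : R[i], forall x, `|S x| <= M * `|x|.
  exists (opnorm T) => x; have [->|Sx0] := eqVneq (S x) 0.
    by rewrite normr0 mulr_ge0// opnorm_ge0.
  rewrite -(ler_pM2r (_ : 0 < `|S x|)) ?normr_gt0// -expr2 hdot_norm -TS.
  rewrite -[leLHS]ger0_norm ?TS ?dnorm_ge0// -TS (le_trans (hdot_le _ _))//.
  by rewrite mulrAC ler_wpM2r// opnorm_le.
by exists (Bop Slin Sbnd).
Qed.

Definition adj T : bop H := projT1 (cid (adjoint_exists T)).

Lemma adjP T x y : hdot (T x) y = hdot x (adj T y).
Proof. exact: (projT2 (cid (adjoint_exists T))). Qed.

Lemma adj_unique T S : (forall x y, hdot (T x) y = hdot x (S y)) -> adj T = S.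
Proof.
by move=> TS; apply: bopP => y; apply: hdot_inj => x; rewrite -adjP.
Qed.

End Adjoint.

Section BlockOperators.
Variables (R : realType) (I : finType) (H : hilbertType R).
Implicit Types x : I -> I -> bop H.

Definition opker_fun x (f : ell2 I H) : ell2 I H :=
  [ffun i => \sum_j x i j (f j)].

Fact opker_linear x : linear (opker_fun x).
Proof.
move=> a f g; apply/ffunP => i; rewrite !ffunE scaler_sumr -big_split/=.
by apply: eq_bigr => j _; rewrite !ffunE linearP.
Qed.

Fact opker_bounded x :
  exists M : R[i], forall f, `|opker_fun x f| <= M * `|f|.
Proof.
exists (\sum_i \sum_j `|x i j|) => f; rewrite (le_trans (ell2_norm_sum _))//.
rewrite mulr_suml; apply: ler_sum => i _; rewrite ffunE mulr_suml.
rewrite (le_trans (ler_norm_sum _ _ _))//; apply: ler_sum => j _.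
apply: (le_trans (opnorm_le (x i j) (f j))).
by apply: ler_wpM2l; [exact: opnorm_ge0|exact: ell2_norm_coord].
Qed.

(* The operator on l_2(I, H) with block matrix x. *)
Definition opker x : bop (ell2 I H) := Bop (opker_linear x) (opker_bounded x).

Definition diagop (a : I -> bop H) : bop (ell2 I H) :=
  opker (fun i j => a i *+ (i == j)).

(* T (x) s on H (x) l_2(I), for the operator s on l_2(I) with matrix s. *)
Definition tensop (T : bop H) (s : I -> I -> R[i]) : bop (ell2 I H) :=
  opker (fun i j => s i j *: T).

End BlockOperators.

Definition opmx (R : realType) (H : hilbertType R) (n : nat)
    (x : 'M[bop H]_n.+1) : bop (ell2 'I_n.+1 H) :=
  opker x.

Section LeftTranslation.
Variables (R : realType) (G : finZmodType) (H : hilbertType R).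

Definition ltrans_fun (g : G) (f : ell2 G H) : ell2 G H := [ffun h => f (h - g)].

Fact ltrans_linear g : linear (ltrans_fun g).
Proof. by move=> a u v; apply/ffunP => h; rewrite !ffunE. Qed.

Fact ltrans_bounded g : exists M : R[i], forall f, `|ltrans_fun g f| <= M * `|f|.
Proof.
exists 1 => f; rewrite mul1r -(@ler_pXn2r _ 2%N) ?nnegrE// !ell2_normE.
rewrite /ell2_dot [leRHS](reindex_inj (@addIr _ (- g)))/=.
by rewrite le_eqVlt; apply/orP; left; apply/eqP/eq_bigr => h _; rewrite !ffunE.
Qed.

(* I (x) l_g on H (x) l_2(G), for the left translation l_g. *)
Definition ltrans g : bop (ell2 G H) := Bop (ltrans_linear g) (ltrans_bounded g).

End LeftTranslation.

Section CstarAlgebras.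
Variables (R : realType) (H : hilbertType R).
Implicit Types (S : set (bop H)) (X Y : bop H).

(* Not assumed to contain the identity. *)
Definition cstar_subalgebra S : Prop :=
  [/\ S 0,
      forall a X Y, S X -> S Y -> S (a *: X + Y),
      forall X Y, S X -> S Y -> S (X * Y),
      forall X, S X -> S (adj X) &
      closed S].

Definition cstar_gen S : set (bop H) := smallest cstar_subalgebra S.

Definition positive_op X : Prop := forall x, 0 <= hdot (X x) x.

Definition unitary_op X : Prop := adj X * X = 1 /\ X * adj X = 1.

(* Only the values of E on C matter.  Complete positivity follows from
   positivity and the bimodule property. *)
Definition cond_expectation (C A : set (bop H)) (E : bop H -> bop H) : Prop :=
  [/\ forall a X Y, C X -> C Y -> E (a *: X + Y) = a *: E X + E Y,
      forall X, C X -> A (E X),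
      forall X, A X -> E X = X,
      forall X A1 A2, C X -> A A1 -> A A2 -> E (A1 * X * A2) = A1 * E X * A2 &
      forall X, C X -> `|E X| <= `|X| /\ positive_op (E (adj X * X))].

Definition faithful_expectation (C : set (bop H)) (E : bop H -> bop H) : Prop :=
  forall X, C X -> E (adj X * X) = 0 -> X = 0.

End CstarAlgebras.

Definition star_hom_on (R : realType) (H K : hilbertType R) (S : set (bop H))
    (Phi : bop H -> bop K) : Prop :=
  [/\ forall a X Y, S X -> S Y -> Phi (a *: X + Y) = a *: Phi X + Phi Y,
      forall X Y, S X -> S Y -> Phi (X * Y) = Phi X * Phi Y &
      forall X, S X -> Phi (adj X) = adj (Phi X)].

Definition star_iso (R : realType) (H K : hilbertType R) (S : set (bop H))
    (S' : set (bop K)) (Phi : bop H -> bop K) : Prop :=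
  star_hom_on S Phi /\ set_bij S S' Phi.

Section CrossedProduct.
Variables (R : realType) (G : finZmodType) (M : hilbertType R).
Implicit Types (A : set (bop M)) (alpha : G -> bop M -> bop M).

Definition star_action A alpha : Prop :=
  [/\ forall g, star_iso A A (alpha g),
      forall X, A X -> alpha 0 X = X &
      forall g h X, A X -> alpha (g + h) X = alpha g (alpha h X)].

(* The matrix units in the sum are the rank one projections E_g, and
   alpha (- g) is the inverse of alpha g. *)
Definition Psi alpha (X : bop M) : bop (ell2 G M) :=
  \sum_g tensop (alpha (- g) X) (fun i j => ((i == g) && (j == g))%:R).

(* The reduced crossed product by a finite abelian group, written additively. *)
Definition crossed_product A alpha : set (bop (ell2 G M)) :=
  cstar_gen ((Psi alpha @` A) `|` range (@ltrans R G M)).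

End CrossedProduct.

Section Coefficients.
Variables (R : realType) (G : finZmodType) (H : hilbertType R).
Variables (L : G -> bop H) (pi : bop H -> bop H).

(* C is generated by A and by the unitaries L g implementing the action of G. *)
Definition crossed_expectation (C A : set (bop H)) : Prop :=
  [/\ cond_expectation C A pi, faithful_expectation C pi &
      forall g X, A X -> pi (L g * X) = X *+ (g == 0)].

Definition coefficient (X : bop H) (g : G) : bop H := pi (adj (L g) * X).

Definition hadamard (X Y : bop H) : bop H :=
  \sum_g L g * coefficient X g * coefficient Y g.

End Coefficients.

Definition block_schur (R : realType) (H : hilbertType R) (n : nat)
    (x y : 'M[bop H]_n) : 'M[bop H]_n :=
  \matrix_(i, j) (x i j * y i j).

(* S, with tau, is the algebraic tensor product of V1 and V2. *)
Definition tensor_product (K : nzRingType) (V1 V2 W : lmodType K) (S : set W)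
    (tau : V1 -> V2 -> W) : Prop :=
  [/\ bilinear_for *:%R *:%R tau,
      forall u v, S (tau u v) &
      forall (V : lmodType K) (beta : {bilinear V1 -> V2 -> V}),
        let extends (phi : W -> V) :=
          (forall a x y, S x -> S y -> phi (a *: x + y) = a *: phi x + phi y) /\
          (forall u v, phi (tau u v) = beta u v) in
        exists2 phi, extends phi &
          forall psi, extends psi -> {in S, psi =1 phi}].

(* Main.v *)
Require Import Defs.
From mathcomp Require Import all_boot all_order all_algebra.
From mathcomp Require Import all_classical all_reals all_analysis.
From mathcomp Require Import sesquilinear complex.

Set Implicit Arguments.
Unset Strict Implicit.
Unset Printing Implicit Defensive.

Import Order.TTheory GRing.Theory Num.Theory.
Import numFieldNormedType.Exports.

Local Open Scope classical_set_scope.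
Local Open Scope complex_scope.
Local Open Scope ring_scope.

(** An operator on l_2(I, H), with I finite, is determined by its blocks, the
compressions T_ij of T to the summands H, and sums, products and adjoints of
operators are computed on blocks as for matrices (block_inj, blockM,
block_adj).  So B(l_2(I, H)) consists of all matrices over B(H), and an
identity between operators is an identity between blocks.

Let G be a finite abelian group, written additively.  The block at (i, j) of
L_g T is the block of T at (i - g, j); hence L_g moves the diagonal to the g-th
generalised diagonal, and
  T = sum_g L_g T_g, where T_g is diagonal with entries T_{k+g,k}
(ltrans_expansion).  Therefore the diagonal operators and the translations
generate all of B(l_2(G, H)).  A conditional expectation that kills L_g A for
nonzero g keeps the summand with g = 0 of this expansion, so it is the diagonal
projection (crossed_expectation_unique), and T_g is the g-th coefficient of T.
As X_g Y_g has the entries X_{k+g,k} Y_{k+g,k}, it is the g-th coefficient of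
the block Schur product, and resumming the expansion identifies the Hadamard
product with that product (block_hadamard).

The isomorphism with the crossed product sends X to the operator on
l_2(G, l_2(G, H)) whose block at (i, j) is the diagonal operator with entries
X_{k+i,k+j}, k in G.  After exchanging the two copies of G this is the direct
sum over k of the operators L_k^* X L_k, which explains why it is an injective
*-homomorphism.  It extends Psi and maps L_g to the g-th translation.  Its
range is cut out by linear equations between blocks, which depend continuously
on the operator; so the range is a C*-algebra, and it is the crossed product
(crossed_productE).  The isomorphism intertwines the diagonal projections, so
the expectation of the crossed product is again a diagonal projection. *)

(** * Algebra of bounded operators *)

Section BoundedOperatorAlgebra.
Variables (R : realType) (H : hilbertType R).
Implicit Types S T : bop H.

Lemma bop_sumE (I : Type) (r : seq I) (P : pred I) (F : I -> bop H) v :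
  (\sum_(i <- r | P i) F i) v = \sum_(i <- r | P i) F i v.
Proof. by apply: (big_morph (fun T : bop H => T v)). Qed.

Lemma bop_mulrnE T m v : (T *+ m) v = T v *+ m.
Proof.
elim: m => [|m IHm]; first by rewrite !mulr0n.
by rewrite !mulrS -IHm.
Qed.

Lemma bop_scalerAl c S T : c *: (S * T) = (c *: S) * T.
Proof. exact: bopP. Qed.

Lemma bop_scalerAr c S T : c *: (S * T) = S * (c *: T).
Proof. by apply: bopP => v /=; exact/esym/linearZ. Qed.

Lemma adj_dot T x y : hdot (adj T x) y = hdot x (T y).
Proof. by rewrite dotC -adjP -dotC. Qed.

Lemma adj_lin c S T : adj (c *: S + T) = c^* *: adj S + adj T.
Proof.
apply: adj_unique => x y; rewrite dotDl dotDr.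
by rewrite dotZl dotZr conjCK !adjP.
Qed.

Lemma adj0 : adj (0 : bop H) = 0.
Proof. by apply: adj_unique => x y; rewrite dot0l dot0r. Qed.

Lemma adj1 : adj (1 : bop H) = 1.
Proof. exact: adj_unique. Qed.

Lemma adjD S T : adj (S + T) = adj S + adj T.
Proof. by rewrite -[S]scale1r adj_lin rmorph1 !scale1r. Qed.

Lemma adjZ c T : adj (c *: T) = c^* *: adj T.
Proof. by rewrite -[c *: T]addr0 adj_lin adj0 addr0. Qed.

Lemma adjMn T m : adj (T *+ m) = adj T *+ m.
Proof.
elim: m => [|m IHm]; first by rewrite !mulr0n adj0.
by rewrite !mulrS adjD IHm.
Qed.

End BoundedOperatorAlgebra.

(** * Blocks of an operator on l_2(I, H) *)

Section Blocks.
Variables (R : realType) (I : finType) (H : hilbertType R).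
Local Notation L := (ell2 I H).
Implicit Types S T : bop L.

(** The elementary tensor of v with the j-th basis vector of l_2(I). *)
Definition coord_vec (j : I) (v : H) : L := [ffun i => v *+ (i == j)].

Lemma coord_vecE j v i : coord_vec j v i = v *+ (i == j).
Proof. by rewrite ffunE. Qed.

Lemma coord_vec_linear j : linear (coord_vec j).
Proof.
move=> a u v; apply/ffunP => i; rewrite !ffunE.
by rewrite mulrnDl -scalerMnr.
Qed.

Lemma ell2_sum_coord (f : L) : f = \sum_j coord_vec j (f j).
Proof.
apply/ffunP => i; rewrite sum_ffunE (bigD1 i)//= coord_vecE eqxx.
by rewrite big1 ?addr0// => j ij; rewrite coord_vecE eq_sym (negPf ij).
Qed.

Lemma norm_coord_vec j v : `|coord_vec j v| = `|v|.
Proof.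
apply/eqP; rewrite -(@eqrXn2 _ 2%N)// ell2_normE hdot_norm /ell2_dot.
rewrite (bigD1 j)//= coord_vecE eqxx big1 ?addr0//.
by move=> i ij; rewrite coord_vecE (negPf ij) dot0l.
Qed.

Definition block_fun T i j (v : H) : H := T (coord_vec j v) i.

Fact block_linear T i j : linear (block_fun T i j).
Proof.
by move=> a u v; rewrite /block_fun coord_vec_linear linearP !ffunE.
Qed.

Lemma block_fun_le T i j v : `|block_fun T i j v| <= `|T| * `|v|.
Proof.
rewrite (le_trans (ell2_norm_coord _ _))// -(norm_coord_vec j).
exact: opnorm_le.
Qed.

Fact block_bounded T i j :
  exists M : R[i], forall v, `|block_fun T i j v| <= M * `|v|.
Proof. by exists `|T| => v; exact: block_fun_le. Qed.

Definition block T i j : bop H := Bop (block_linear T i j) (block_bounded T i j).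

Lemma blockE T i j v : block T i j v = T (coord_vec j v) i.
Proof. by []. Qed.

Lemma block_norm T i j : `|block T i j| <= `|T|.
Proof.
apply: opnorm_lub => v v1; rewrite (le_trans (block_fun_le T i j v))//.
by rewrite ler_piMr.
Qed.

Lemma opkerE (x : I -> I -> bop H) (f : L) i :
  opker x f i = \sum_j x i j (f j).
Proof. by rewrite ffunE. Qed.

Lemma block_opker x i j : block (opker x) i j = x i j.
Proof.
apply: bopP => v; rewrite blockE opkerE (bigD1 j)//= coord_vecE eqxx.
by rewrite big1 ?addr0// => k kj; rewrite coord_vecE (negPf kj) linear0.
Qed.

Lemma opker_block T : opker (block T) = T.
Proof.
apply: bopP => f; apply/ffunP => i; rewrite opkerE.
by rewrite [in RHS](ell2_sum_coord f) linear_sum sum_ffunE.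
Qed.

(** The extensionality principle on which all later identities rest: each of
them is checked on blocks. *)
Lemma block_inj S T : (forall i j, block S i j = block T i j) -> S = T.
Proof.
move=> ST; rewrite -(opker_block S) -(opker_block T); apply: bopP => f.
by apply/ffunP => i; rewrite !opkerE; apply: eq_bigr => j _; rewrite ST.
Qed.

Lemma block0 i j : block 0 i j = 0.
Proof. by apply: bopP => v; rewrite blockE /= ffunE. Qed.

Lemma block1 i j : block 1 i j = 1 *+ (i == j).
Proof. by apply: bopP => v; rewrite blockE bop_mulrnE /= coord_vecE. Qed.

Lemma blockD S T i j : block (S + T) i j = block S i j + block T i j.
Proof. by apply: bopP => v; rewrite blockE /= ffunE. Qed.

Lemma blockZ a T i j : block (a *: T) i j = a *: block T i j.
Proof. by apply: bopP => v; rewrite blockE /= ffunE. Qed.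

Lemma block_sum (J : Type) (r : seq J) (P : pred J) (F : J -> bop L) i j :
  block (\sum_(k <- r | P k) F k) i j = \sum_(k <- r | P k) block (F k) i j.
Proof.
by apply: (big_morph (fun T => block T i j)) => [S T|]; rewrite ?blockD ?block0.
Qed.

Lemma blockMn T m i j : block (T *+ m) i j = block T i j *+ m.
Proof.
elim: m => [|m IHm]; first by rewrite !mulr0n block0.
by rewrite !mulrS blockD IHm.
Qed.

Lemma blockM S T i k : block (S * T) i k = \sum_j block S i j * block T j k.
Proof.
apply: bopP => v; rewrite bop_sumE blockE /=.
by rewrite (ell2_sum_coord (T _)) linear_sum sum_ffunE.
Qed.

(** The matrix of block adjoints satisfies the defining identity of the adjoint,
by exchanging the two sums over I. *)
Lemma block_adj T i j : block (adj T) i j = adj (block T j i).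
Proof.
rewrite -(block_opker (fun i j => adj (block T j i)) i j); congr (block _ i j).
apply: adj_unique => f g; rewrite -{1}(opker_block T).
transitivity (\sum_i \sum_j hdot (block T i j (f j)) (g i)).
  by apply: eq_bigr => k _; rewrite opkerE dot_suml.
rewrite exchange_big; apply: eq_bigr => k _.
by rewrite opkerE dot_sumr; apply: eq_bigr => l _; rewrite adjP.
Qed.

Lemma block_diagop a i j : block (diagop a) i j = a i *+ (i == j).
Proof. exact: block_opker. Qed.

Lemma block_tensop (T : bop H) s i j : block (tensop T s) i j = s i j *: T.
Proof. exact: block_opker. Qed.

(** Compressing to a block is a contraction.  This is what makes the algebras
defined by equations between blocks norm closed. *)
Lemma block_continuous i j : continuous (fun T => block T i j).
Proof.
move=> T; apply/(@cvgrPdist_lt _ _ _ _ (nbhs_filter T)) => e e0.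
apply: filterS (nbhsx_ballx T e e0) => S; rewrite -ball_normE /=.
have -> : block T i j - block S i j = block (T - S) i j.
  by rewrite blockD -[- S]scaleN1r blockZ scaleN1r.
exact/le_lt_trans/block_norm.
Qed.

End Blocks.

(** * Closedness and generation *)

Lemma closed_zeros (K : numFieldType) (V W : normedModType K) (J : Type)
    (P : set J) (f : J -> V -> W) :
  (forall j, continuous (f j)) -> closed [set v | forall j, P j -> f j v = 0].
Proof.
move=> cf; apply: (@closed_bigI _ _ P (fun j => [set v | f j v = 0])) => j _.
apply: (@closed_comp _ _ (f j) [set 0]); first by move=> v _; exact: cf.
exact/accessible_closed_set1/hausdorff_accessible/norm_hausdorff.
Qed.

Section GeneratedAlgebra.
Variables (R : realType) (H : hilbertType R).

Lemma cstar_gen_sum (S : set (bop H)) (J : finType) (u v : J -> bop H) :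
  (forall j, S (u j)) -> (forall j, S (v j)) ->
  cstar_gen S (\sum_j u j * v j).
Proof.
move=> Su Sv B [[B0 BD BM _ _] SB]; apply: (big_ind B) => //.
- by move=> x y Bx By; rewrite -[x]scale1r; exact: BD.
- by move=> j _; apply: BM; apply: SB.
Qed.

End GeneratedAlgebra.

(** * The diagonal algebra and the diagonal projection *)

Section DiagonalExpectation.
Variables (R : realType) (I : finType) (H : hilbertType R).
Local Notation L := (ell2 I H).
Implicit Types (S T : bop L) (a b : I -> bop H).

Lemma diagop_inj : injective (@diagop R I H).
Proof.
move=> a b ab; apply/funext => i.
by have /(congr1 (fun T => block T i i)) := ab; rewrite !block_diagop eqxx.
Qed.

Lemma diagop_lin c a b :
  c *: diagop a + diagop b = diagop (fun i => c *: a i + b i).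
Proof.
apply: block_inj => i j; rewrite blockD blockZ !block_diagop mulrnDl.
by rewrite scalerMnr.
Qed.

Lemma diagop_sum (J : finType) (a : J -> I -> bop H) :
  \sum_j diagop (a j) = diagop (fun k => \sum_j a j k).
Proof.
apply: block_inj => i j; rewrite block_sum block_diagop -sumrMnl.
by apply: eq_bigr => l _; rewrite block_diagop.
Qed.

Lemma block_diagop_mul a T i j : block (diagop a * T) i j = a i * block T i j.
Proof.
rewrite blockM (bigD1 i)//= block_diagop eqxx big1 ?addr0// => k ki.
by rewrite block_diagop eq_sym (negPf ki) mul0r.
Qed.

Lemma block_mul_diagop a T i j : block (T * diagop a) i j = block T i j * a j.
Proof.
rewrite blockM (bigD1 j)//= block_diagop eqxx big1 ?addr0// => k kj.
by rewrite block_diagop (negPf kj) mulr0.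
Qed.

Lemma diagopM a b : diagop a * diagop b = diagop (fun i => a i * b i).
Proof.
apply: block_inj => i j; rewrite block_diagop_mul !block_diagop.
by rewrite mulrnAr.
Qed.

Lemma adj_diagop a : adj (diagop a) = diagop (fun i => adj (a i)).
Proof.
apply: block_inj => i j; rewrite block_adj !block_diagop adjMn eq_sym.
by case: eqP => // ->.
Qed.

(** Describes the diagonal algebra by equations between blocks, whence its
closedness. *)
Lemma range_diagopE :
  range (@diagop R I H) =
  [set T | forall p : I * I, p.1 != p.2 -> block T p.1 p.2 = 0].
Proof.
apply/seteqP; split=> [_ [a _ <-] p ij|T T0].
  by rewrite block_diagop (negPf ij).
exists (fun i => block T i i) => //; apply: block_inj => i j.
by rewrite block_diagop; have [->//|/(T0 (i, j))] := eqVneq i j.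
Qed.

Lemma cstar_diagop : cstar_subalgebra (range (@diagop R I H)).
Proof.
split.
- exists (fun=> 0) => //; apply: block_inj => i j.
  by rewrite block_diagop block0 mul0rn.
- move=> c _ _ [a _ <-] [b _ <-]; rewrite diagop_lin.
  by exists (fun i => c *: a i + b i).
- move=> _ _ [a _ <-] [b _ <-]; rewrite diagopM.
  by exists (fun i => a i * b i).
- by move=> _ [a _ <-]; rewrite adj_diagop; exists (fun i => adj (a i)).
- rewrite range_diagopE; apply: closed_zeros => p; exact: block_continuous.
Qed.

Definition diag_proj T : bop L := diagop (fun i => block T i i).

Lemma block_diag_proj T i j : block (diag_proj T) i j = block T i i *+ (i == j).
Proof. exact: block_diagop. Qed.

Lemma diag_proj_diagop a : diag_proj (diagop a) = diagop a.
Proof.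
by apply: block_inj => i j; rewrite block_diag_proj !block_diagop eqxx.
Qed.

(** A diagonal operator acts coordinatewise, and each of its entries T_ii is a
compression of T. *)
Lemma diag_proj_norm T : `|diag_proj T| <= `|T|.
Proof.
apply: opnorm_lub => f f1; rewrite (@le_trans _ _ (`|T| * `|f|))//; last first.
  by rewrite ler_piMr.
rewrite -(@ler_pXn2r _ 2%N) ?nnegrE ?mulr_ge0// exprMn !ell2_normE.
rewrite /ell2_dot mulr_sumr; apply: ler_sum => i _.
have -> : diag_proj T f i = block T i i (f i).
  rewrite opkerE (bigD1 i)//= eqxx big1 ?addr0// => j ij.
  by rewrite eq_sym (negPf ij).
rewrite -!hdot_norm -exprMn ler_pXn2r ?nnegrE ?mulr_ge0//.
exact: block_fun_le.
Qed.

(** The k-th diagonal entry of T^* T is the sum over j of the operators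
T_jk^* T_jk.  Both positivity and faithfulness of the diagonal projection
follow. *)
Lemma hdot_block_adjM T k v :
  hdot (block (adj T * T) k k v) v = \sum_j `|block T j k v| ^+ 2.
Proof.
rewrite blockM bop_sumE dot_suml; apply: eq_bigr => j _.
by rewrite block_adj hdot_norm /= adj_dot.
Qed.

Lemma diag_proj_positive T : positive_op (diag_proj (adj T * T)).
Proof.
move=> f; apply: sumr_ge0 => i _; rewrite opkerE (bigD1 i)//= eqxx.
rewrite big1 ?addr0; last by move=> j ij; rewrite eq_sym (negPf ij).
by rewrite hdot_block_adjM sumr_ge0// => j _; rewrite exprn_ge0.
Qed.

Lemma diag_proj_faithful T : diag_proj (adj T * T) = 0 -> T = 0.
Proof.
move=> T0; apply: block_inj => i k; rewrite block0; apply: bopP => v.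
have /(congr1 (fun S => hdot (block S k k v) v)) := T0.
rewrite block_diag_proj eqxx hdot_block_adjM block0 dot0l => /eqP.
rewrite psumr_eq0 => [/allP/(_ i)|j _]; last exact: exprn_ge0.
by rewrite mem_index_enum expf_eq0/= normr_eq0 => /(_ isT) /eqP.
Qed.

(** Stated for any algebra that the diagonal projection maps into diagonal
operators B, because it serves on B(l_2(G, H)) and, with l_2(G, H) in place of
H, on the crossed product. *)
Lemma cond_expectation_diag_proj (C B : set (bop L)) :
  B `<=` range (@diagop R I H) -> (forall X, C X -> B (diag_proj X)) ->
  cond_expectation C B diag_proj.
Proof.
move=> Bdiag CB; split=> //.
- move=> c X Y _ _; rewrite diagop_lin; congr diagop; apply/funext => i.
  by rewrite blockD blockZ.
- by move=> X /Bdiag[a _ <-]; exact: diag_proj_diagop.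
- move=> X _ _ _ /Bdiag[a _ <-] /Bdiag[b _ <-]; rewrite !diagopM.
  by congr diagop; apply/funext => i; rewrite block_mul_diagop block_diagop_mul.
- by move=> X _; split; [exact: diag_proj_norm|exact: diag_proj_positive].
Qed.

End DiagonalExpectation.

(** * Translations, coefficients and the Hadamard product *)

Section Translations.
Variables (R : realType) (G : finZmodType) (H : hilbertType R).
Local Notation L := (@ltrans R G H).
Implicit Types (T X Y : bop (ell2 G H)) (a : G -> bop H).

Lemma block_ltrans_mul g T i j : block (L g * T) i j = block T (i - g) j.
Proof. by apply: bopP => v; rewrite !blockE /= ffunE. Qed.

Lemma block_ltrans g i j : block (L g) i j = 1 *+ (i - g == j).
Proof. by rewrite -[L g]mulr1 block_ltrans_mul block1. Qed.

Lemma ltrans0 : L 0 = 1.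
Proof. by apply: block_inj => i j; rewrite block_ltrans block1 subr0. Qed.

Lemma ltransD f g : L (f + g) = L f * L g.
Proof.
by apply: block_inj => i j; rewrite block_ltrans_mul !block_ltrans opprD addrA.
Qed.

Lemma adj_ltrans g : adj (L g) = L (- g).
Proof.
apply: block_inj => i j; rewrite block_adj !block_ltrans adjMn adj1 opprK.
by rewrite subr_eq eq_sym.
Qed.

Lemma ltrans_unitary g : unitary_op (L g).
Proof. by split; rewrite adj_ltrans -ltransD ?addNr ?subrr ltrans0. Qed.

Lemma ltrans_conj g a :
  L g * diagop a * adj (L g) = diagop (fun h => a (h - g)).
Proof.
apply: block_inj => i j; rewrite -mulrA block_ltrans_mul block_diagop_mul.
rewrite adj_ltrans block_ltrans block_diagop opprK subrK.
by rewrite mulrnAr mulr1.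
Qed.

(** Splits the matrix T along its generalised diagonals: the block at (i, j)
comes only from the summand with g = i - j. *)
Lemma ltrans_expansion T :
  T = \sum_g L g * diagop (fun k => block T (k + g) k).
Proof.
apply: block_inj => i j; rewrite block_sum (bigD1 (i - j))//=.
rewrite block_ltrans_mul block_diagop subKr eqxx [j + _]addrC subrK.
rewrite big1 ?addr0// => g gij.
rewrite block_ltrans_mul block_diagop; case: eqP => // igj.
by rewrite -igj subKr eqxx in gij.
Qed.

Lemma diag_proj_ltrans g a :
  diag_proj (L g * diagop a) = diagop a *+ (g == 0).
Proof.
apply: block_inj => i j; rewrite block_diag_proj block_ltrans_mul blockMn.
rewrite !block_diagop -subr_eq0 addrAC subrr add0r oppr_eq0.
by case: eqP => [->|]; rewrite ?subr0 ?mul0rn// mulr1n.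
Qed.

Lemma crossed_expectation_diag_proj (C B : set (bop (ell2 G H))) :
  B `<=` range (@diagop R G H) -> (forall X, C X -> B (diag_proj X)) ->
  crossed_expectation L (@diag_proj R G H) C B.
Proof.
move=> Bdiag CB; split; first exact: cond_expectation_diag_proj.
- by move=> X _; exact: diag_proj_faithful.
- by move=> g X /Bdiag[a _ <-]; exact: diag_proj_ltrans.
Qed.

(** Applying pi to the expansion of T leaves the summand with g = 0, which is
the diagonal of T. *)
Lemma crossed_expectation_unique pi (C : set (bop (ell2 G H))) :
  C = setT -> crossed_expectation L pi C (range (@diagop R G H)) ->
  pi = @diag_proj R G H.
Proof.
move=> -> [[piP _ _ _ _] _ piL]; apply/funext => T.
have piD X Y : pi (X + Y) = pi X + pi Y.
  by have := piP 1 X Y I I; rewrite !scale1r.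
have pi0 : pi 0 = 0.
  by apply: (addIr (pi 0)); rewrite -piD !add0r.
rewrite {1}[T]ltrans_expansion (big_morph pi piD pi0) (bigD1 0)//=.
rewrite big1 => [|g g0]; last by rewrite piL ?(negPf g0)//; exact: imageT.
rewrite piL; last exact: imageT.
by rewrite eqxx addr0; congr diagop; apply/funext => k; rewrite addr0.
Qed.

Lemma coefficient_ltrans T g :
  coefficient L (@diag_proj R G H) T g = diagop (fun k => block T (k + g) k).
Proof.
congr diagop; apply/funext => k.
by rewrite adj_ltrans block_ltrans_mul opprK.
Qed.

(** The Hadamard product is the expansion of the block Schur product along its
generalised diagonals, since diagonal operators multiply entrywise. *)
Lemma block_hadamard X Y i j :
  block (hadamard L (@diag_proj R G H) X Y) i j = block X i j * block Y i j.
Proof.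
rewrite block_sum -(block_opker (fun i j => block X i j * block Y i j) i j).
rewrite [opker _]ltrans_expansion block_sum; apply: eq_bigr => g _.
rewrite !coefficient_ltrans -mulrA diagopM; congr (block (_ * diagop _) i j).
by apply/funext => k; rewrite block_opker.
Qed.

Lemma cstar_gen_translations :
  cstar_gen (range (@diagop R G H) `|` range L) = setT.
Proof.
apply/seteqP; split=> // T _; rewrite [T]ltrans_expansion.
by apply: cstar_gen_sum => g; [right|left]; exact: imageT.
Qed.

End Translations.

(** * The isomorphism with the crossed product *)

Section CrossedProductIso.
Variables (R : realType) (G : finZmodType) (H : hilbertType R).
Variable alpha : G -> bop (ell2 G H) -> bop (ell2 G H).
Hypothesis alphaE : forall f (a : G -> bop H),
  alpha f (diagop a) = diagop (fun g => a (g - f)).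
Local Notation A := (range (@diagop R G H)).
Local Notation L := (@ltrans R G H).
Local Notation lam := (@ltrans R G (ell2 G H)).
Implicit Types (X Y : bop (ell2 G H)) (T : bop (ell2 G (ell2 G H))).

Lemma alpha_conj f X : A X -> alpha f X = L f * X * adj (L f).
Proof. by move=> [a _ <-]; rewrite ltrans_conj alphaE. Qed.

Lemma alpha_star_action : star_action A alpha.
Proof.
split.
- move=> g; split; split.
  + move=> c _ _ [a _ <-] [b _ <-].
    by rewrite diagop_lin !alphaE diagop_lin.
  + by move=> _ _ [a _ <-] [b _ <-]; rewrite diagopM !alphaE diagopM.
  + by move=> _ [a _ <-]; rewrite adj_diagop !alphaE adj_diagop.
  + by move=> _ [a _ <-]; rewrite alphaE; exact: imageT.
  + move=> _ _ /set_mem[a _ <-] /set_mem[b _ <-]; rewrite !alphaE.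
    move=> /diagop_inj ab; congr diagop; apply/funext => h.
    by have := congr1 (@^~ (h + g)) ab; rewrite /= addrK.
  + move=> _ [a _ <-]; exists (diagop (fun h => a (h + g))).
      exact: imageT.
    by rewrite alphaE; congr diagop; apply/funext => h; rewrite subrK.
- move=> _ [a _ <-]; rewrite alphaE; congr diagop.
  by apply/funext => h; rewrite subr0.
- move=> f g _ [a _ <-]; rewrite !alphaE; congr diagop.
  by apply/funext => h; rewrite opprD addrA.
Qed.

Lemma PsiE X : Psi alpha X = diagop (fun g => alpha (- g) X).
Proof.
apply: block_inj => i j; rewrite block_sum block_diagop (bigD1 i)//=.
rewrite block_tensop eqxx/= big1 ?addr0 => [|g gi].
  by rewrite eq_sym scaler_nat.
by rewrite block_tensop eq_sym (negPf gi) scale0r.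
Qed.

(** The direct sum over k of the operators L_k^* X L_k, with the index k as the
inner coordinate and the matrix indices i, j as the outer ones.  The formula is
forced by X = sum_g L_g X_g: the block at (i, j) of the g-th translation times
Psi(X_g) is nonzero only for g = i - j, and is then alpha_{-j}(X_{i-j}), the
diagonal operator with entries X_{k+i,k+j}. *)
Definition crossed_iso X : bop (ell2 G (ell2 G H)) :=
  opker (fun i j => diagop (fun k => block X (k + i) (k + j))).

Lemma block_crossed_iso X i j :
  block (crossed_iso X) i j = diagop (fun k => block X (k + i) (k + j)).
Proof. exact: block_opker. Qed.

Lemma crossed_iso_lin c X Y :
  crossed_iso (c *: X + Y) = c *: crossed_iso X + crossed_iso Y.
Proof.
apply: block_inj => i j; rewrite blockD blockZ !block_crossed_iso diagop_lin.
by congr diagop; apply/funext => k; rewrite blockD blockZ.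
Qed.

Lemma crossed_isoD : {morph crossed_iso : X Y / X + Y}.
Proof. by move=> X Y; rewrite -[X]scale1r crossed_iso_lin !scale1r. Qed.

Lemma crossed_iso0 : crossed_iso 0 = 0.
Proof. by apply: (addIr (crossed_iso 0)); rewrite -crossed_isoD !add0r. Qed.

Lemma crossed_isoM X Y : crossed_iso (X * Y) = crossed_iso X * crossed_iso Y.
Proof.
apply: block_inj => i j; rewrite blockM block_crossed_iso.
under eq_bigr do rewrite !block_crossed_iso diagopM.
rewrite diagop_sum; congr diagop; apply/funext => k.
by rewrite blockM (reindex_inj (addrI k)).
Qed.

Lemma crossed_iso_adj X : crossed_iso (adj X) = adj (crossed_iso X).
Proof.
apply: block_inj => i j; rewrite block_adj !block_crossed_iso adj_diagop.
by congr diagop; apply/funext => k; rewrite block_adj.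
Qed.

Lemma crossed_iso_inj : injective crossed_iso.
Proof.
move=> X Y XY; apply: block_inj => i j.
have /(congr1 (fun T => block (block T i j) 0 0)) := XY.
by rewrite !block_crossed_iso !block_diagop eqxx !add0r.
Qed.

Lemma crossed_iso_diagop a : crossed_iso (diagop a) = Psi alpha (diagop a).
Proof.
apply: block_inj => i j; rewrite PsiE block_diagop block_crossed_iso alphaE.
apply: block_inj => k l; rewrite blockMn !block_diagop opprK.
by rewrite (inj_eq (addrI k)) mulrnAC.
Qed.

Lemma crossed_iso_ltrans g : crossed_iso (L g) = lam g.
Proof.
apply: block_inj => i j; rewrite block_crossed_iso block_ltrans.
apply: block_inj => k l; rewrite block_diagop blockMn block1 block_ltrans.
by rewrite -addrA (inj_eq (addrI k)) mulrnAC.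
Qed.

Lemma crossed_iso_diag_proj X :
  crossed_iso (diag_proj X) = diag_proj (crossed_iso X).
Proof.
apply: block_inj => i j; rewrite block_diag_proj !block_crossed_iso.
apply: block_inj => k l; rewrite blockMn !block_diagop.
by rewrite (inj_eq (addrI k)) mulrnAC.
Qed.

(** T is in the range if and only if its outer blocks T_ij are diagonal and the
k-th entry of T_ij equals the entry at 0 of T_{k+i,k+j}: then T is the image of
the matrix of the entries at 0. *)
Lemma range_crossed_isoE :
  range crossed_iso =
  [set T | forall p : (G * G) * (G * G), True ->
    block (block T p.1.1 p.1.2) p.2.1 p.2.2 -
    block (block T (p.2.1 + p.1.1) (p.2.1 + p.1.2)) 0 0
      *+ (p.2.1 == p.2.2) = 0].
Proof.
apply/seteqP; split=> [_ [X _ <-] [[i j] [k l]] _ /=|T Tinv].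
  by rewrite !block_crossed_iso !block_diagop eqxx !add0r subrr.
exists (opker (fun i j => block (block T i j) 0 0)) => //.
apply: block_inj => i j; rewrite block_crossed_iso.
apply: block_inj => k l; rewrite block_diagop block_opker.
by have /eqP := Tinv ((i, j), (k, l)) I; rewrite subr_eq0 => /eqP.
Qed.

Lemma cstar_range_crossed_iso : cstar_subalgebra (range crossed_iso).
Proof.
have block2_continuous i j k l :
    continuous (fun T => block (block T i j) k l).
  move=> T; exact: (continuous_comp (@block_continuous _ _ _ i j T)
    (@block_continuous _ _ _ k l (block T i j))).
split.
- by exists 0 => //; exact: crossed_iso0.
- move=> c _ _ [X _ <-] [Y _ <-]; rewrite -crossed_iso_lin; exact: imageT.
- move=> _ _ [X _ <-] [Y _ <-]; rewrite -crossed_isoM; exact: imageT.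
- move=> _ [X _ <-]; rewrite -crossed_iso_adj; exact: imageT.
- rewrite range_crossed_isoE; apply: closed_zeros => -[[i j] [k l]] /= T.
  have cr : {for T, continuous
      (fun S => block (block S (k + i) (k + j)) 0 0 *+ (k == l))}.
    case: (k == l); first exact: block2_continuous.
    exact: cst_continuous.
  exact: (@continuousB _ _ _ _ _ T (block2_continuous i j k l T) cr).
Qed.

(** One inclusion holds since the range is a C*-algebra containing the
generators, the other since the image of the expansion of X is a sum of products
of generators. *)
Lemma crossed_productE : crossed_product A alpha = range crossed_iso.
Proof.
apply/seteqP; split.
  apply: smallest_sub; first exact: cstar_range_crossed_iso.
  move=> _ [[_ [a _ <-] <-]|[g _ <-]].
  - by exists (diagop a) => //; exact: crossed_iso_diagop.
  - by exists (L g) => //; exact: crossed_iso_ltrans.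
move=> _ [X _ <-]; rewrite [X]ltrans_expansion.
have -> (a : G -> G -> bop H) :
    crossed_iso (\sum_g L g * diagop (a g)) =
    \sum_g lam g * Psi alpha (diagop (a g)).
  rewrite (big_morph _ crossed_isoD crossed_iso0).
  by apply: eq_bigr => g _; rewrite crossed_isoM crossed_iso_ltrans
    crossed_iso_diagop.
apply: cstar_gen_sum => g; [right; exact: imageT|left].
by exists (diagop (fun k => block X (k + g) k)) => //; exact: imageT.
Qed.

Lemma crossed_iso_star_iso :
  star_iso [set: bop (ell2 G H)] (crossed_product A alpha) crossed_iso.
Proof.
split; split.
- by move=> c X Y _ _; exact: crossed_iso_lin.
- by move=> X Y _ _; exact: crossed_isoM.
- by move=> X _; exact: crossed_iso_adj.
- by move=> X _; rewrite crossed_productE; exact: imageT.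
- by move=> X Y _ _; exact: crossed_iso_inj.
- by rewrite crossed_productE.
Qed.

Lemma crossed_product_expectation :
  crossed_expectation lam (@diag_proj R G (ell2 G H))
    (crossed_product A alpha) (Psi alpha @` A).
Proof.
apply: crossed_expectation_diag_proj => [_ [X _ <-]|T].
  by rewrite PsiE; exact: imageT.
rewrite crossed_productE => -[X _ <-]; rewrite -crossed_iso_diag_proj.
exists (diag_proj X); first exact: imageT.
by rewrite -crossed_iso_diagop.
Qed.

End CrossedProductIso.

(** * Matrices over B(H) and the tensor product *)

Section MatrixAlgebra.
Variables (R : realType) (H : hilbertType R) (n : nat).
Local Notation op := (bop (ell2 'I_n.+1 H)).
Implicit Types (x y : 'M[bop H]_n.+1) (X : op).

Lemma block_opmx x i j : block (opmx x) i j = x i j.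
Proof. exact: block_opker. Qed.

Lemma opmx_bij : set_bij [set: 'M[bop H]_n.+1] [set: op] (@opmx R H n).
Proof.
split=> // [x y _ _ xy|X _].
  by apply/matrixP => i j; rewrite -!block_opmx xy.
exists (\matrix_(i, j) block X i j) => //.
by apply: block_inj => i j; rewrite block_opmx mxE.
Qed.

Lemma opmxD x y : opmx (x + y) = opmx x + opmx y.
Proof. by apply: block_inj => i j; rewrite blockD !block_opmx mxE. Qed.

Lemma opmxZ c x : opmx (map_mx ( *:%R c) x) = c *: opmx x.
Proof. by apply: block_inj => i j; rewrite blockZ !block_opmx mxE. Qed.

Lemma opmxM x y : opmx (x *m y) = opmx x * opmx y.
Proof.
apply: block_inj => i j; rewrite blockM block_opmx mxE.
by apply: eq_bigr => k _; rewrite !block_opmx.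
Qed.

Lemma opmx_adj x : opmx (map_mx (@adj R H) x^T) = adj (opmx x).
Proof. by apply: block_inj => i j; rewrite block_adj !block_opmx !mxE. Qed.

Lemma diag_proj_opmx x :
  diag_proj (opmx x) = opmx (\matrix_(k, l) (x k k *+ (k == l))).
Proof.
by apply: block_inj => i j; rewrite block_diag_proj !block_opmx mxE.
Qed.

Lemma tensopM (S T : bop H) (s t : 'M[R[i]]_n.+1) :
  tensop S s * tensop T t = tensop (S * T) (s *m t).
Proof.
apply: block_inj => i j; rewrite blockM block_tensop mxE scaler_suml.
apply: eq_bigr => k _; rewrite !block_tensop.
by rewrite -bop_scalerAl -bop_scalerAr scalerA.
Qed.

Lemma adj_tensop (T : bop H) (s : 'M[R[i]]_n.+1) :
  adj (tensop T s) = tensop (adj T) (map_mx Num.conj s^T).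
Proof.
by apply: block_inj => i j; rewrite block_adj !block_tensop adjZ !mxE.
Qed.

Lemma tensop_expansion X :
  X = \sum_i \sum_j
    tensop (block X i j) (delta_mx i j : 'M[R[i]]_n.+1).
Proof.
apply: block_inj => k l; rewrite block_sum (bigD1 k)//= block_sum (bigD1 l)//=.
rewrite block_tensop mxE !eqxx scale1r !big1 ?addr0// => [i ik|j jl].
  rewrite block_sum big1// => j _.
  by rewrite block_tensop mxE eq_sym (negPf ik) scale0r.
by rewrite block_tensop mxE eqxx eq_sym (negPf jl) scale0r.
Qed.

(** A bilinear map beta factors through the linear map that sends X to the sum of
beta(X_ij, e_ij), and the expansion of X in matrix units e_ij leaves no other
choice. *)
Lemma tensop_tensor_product :
  tensor_product [set: op] (fun (T : bop H) (s : 'M[R[i]]_n.+1) => tensop T s).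
Proof.
split=> // [|V beta extends].
  split=> [s|T] a x y; apply: block_inj => i j; rewrite blockD blockZ.
    by rewrite !block_tensop scalerDr !scalerA mulrC.
  by rewrite !block_tensop !mxE scalerDl scalerA.
exists (fun X : op => \sum_i \sum_j beta (block X i j) (delta_mx i j)).
  split=> [a X Y _ _|T s].
    rewrite scaler_sumr -big_split; apply: eq_bigr => i _ /=.
    rewrite scaler_sumr -big_split; apply: eq_bigr => j _ /=.
    by rewrite blockD blockZ linearPl.
  rewrite [s in RHS]matrix_sum_delta linear_sumr; apply: eq_bigr => i _.
  rewrite linear_sumr; apply: eq_bigr => j _.
  by rewrite block_tensop linearZl_LR linearZr_LR.
move=> psi [psiP psi_tau] X _; rewrite {1}[X]tensop_expansion.
have psiD : {morph psi : S T / S + T}.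
  by move=> S T; have := psiP 1 S T I I; rewrite !scale1r.
have psi0 : psi 0 = 0 by apply: (addIr (psi 0)); rewrite -psiD !add0r.
rewrite (big_morph psi psiD psi0); apply: eq_bigr => i _.
rewrite (big_morph psi psiD psi0); apply: eq_bigr => j _.
exact: psi_tau.
Qed.

End MatrixAlgebra.

(** * The cyclic group *)

(* 'I_n.+1 with its addition modulo n.+1 is the cyclic group of order n.+1,
   so n ranges over all cyclic groups of positive order. *)
Theorem mainTheorem2 (R : realType) (H : hilbertType R) (n : nat)
    (alpha : 'I_n.+1 -> bop (ell2 'I_n.+1 H) -> bop (ell2 'I_n.+1 H))
    (alphaE : forall (f : 'I_n.+1) (a : 'I_n.+1 -> bop H),
        alpha f (diagop a) = diagop (fun g : 'I_n.+1 => a (g - f))) :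
  let A : set (bop (ell2 'I_n.+1 H)) := range (@diagop R 'I_n.+1 H) in
  let L : 'I_n.+1 -> bop (ell2 'I_n.+1 H) := @ltrans R 'I_n.+1 H in
  let C : set (bop (ell2 'I_n.+1 H)) := cstar_gen (A `|` range L) in
  let D : set (bop (ell2 'I_n.+1 (ell2 'I_n.+1 H))) :=
    crossed_product A alpha in
  let lam : 'I_n.+1 -> bop (ell2 'I_n.+1 (ell2 'I_n.+1 H)) :=
    @ltrans R 'I_n.+1 (ell2 'I_n.+1 H) in
  [/\ (* A is a C*-algebra, on which alpha acts, implemented by L *)
      [/\ cstar_subalgebra A,
          star_action A alpha,
          forall g, unitary_op (L g),
          forall f g, L (f + g) = L f * L g &
          forall f X, A X -> alpha f X = L f * X * adj (L f)],
      (* C is the algebra of B(H)-valued matrices ... *)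
      [/\ set_bij [set: 'M[bop H]_n.+1] C (@opmx R H n),
          forall x y : 'M[bop H]_n.+1, opmx (x + y) = opmx x + opmx y,
          forall (c : R[i]) (x : 'M[bop H]_n.+1),
            opmx (map_mx ( *:%R c) x) = c *: opmx x,
          forall x y : 'M[bop H]_n.+1, opmx (x *m y) = opmx x * opmx y &
          forall x : 'M[bop H]_n.+1, opmx (map_mx (@adj R H) x^T) = adj (opmx x)],
      (* ... and the tensor product of B(H) and the scalar matrices *)
      [/\ tensor_product C (fun (T : bop H) (s : 'M[R[i]]_n.+1) => tensop T s),
          forall (S T : bop H) (s t : 'M[R[i]]_n.+1),
            tensop S s * tensop T t = tensop (S * T) (s *m t) &
          forall (T : bop H) (s : 'M[R[i]]_n.+1),
            adj (tensop T s) = tensop (adj T) (map_mx Num.conj s^T)],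
      (* C is isomorphic to the reduced crossed product, and pi corresponds to
         its conditional expectation E *)
      exists (Phi : bop (ell2 'I_n.+1 H) -> bop (ell2 'I_n.+1 (ell2 'I_n.+1 H)))
             (E : bop (ell2 'I_n.+1 (ell2 'I_n.+1 H)) ->
                  bop (ell2 'I_n.+1 (ell2 'I_n.+1 H)))
             (pi : bop (ell2 'I_n.+1 H) -> bop (ell2 'I_n.+1 H)),
        [/\ star_iso C D Phi,
            (forall X, A X -> Phi X = Psi alpha X) /\
            (forall g, Phi (L g) = lam g),
            crossed_expectation lam E D (Psi alpha @` A),
            crossed_expectation L pi C A &
            forall X, C X -> Phi (pi X) = E (Phi X)] &
      forall pi : bop (ell2 'I_n.+1 H) -> bop (ell2 'I_n.+1 H),
        crossed_expectation L pi C A ->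
        [/\ forall x : 'M[bop H]_n.+1,
              pi (opmx x) = opmx (\matrix_(k, l) (x k k *+ (k == l))),
            forall X g, C X -> A (coefficient L pi X g),
            forall X, C X -> X = \sum_g L g * coefficient L pi X g,
            forall X Y g, C X -> C Y ->
              coefficient L pi (hadamard L pi X Y) g =
                coefficient L pi X g * coefficient L pi Y g &
            forall x y : 'M[bop H]_n.+1,
              hadamard L pi (opmx x) (opmx y) = opmx (block_schur x y)]].
Proof.
move=> A L C D lam.
have CT : C = setT by exact: cstar_gen_translations.
rewrite {}CT; split.
- split.
  + exact: cstar_diagop.
  + exact: alpha_star_action.
  + exact: ltrans_unitary.
  + exact: ltransD.
  + exact: alpha_conj.
- split; [exact: opmx_bij|exact: opmxD|exact: opmxZ|exact: opmxM|exact: opmx_adj].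
- split; [exact: tensop_tensor_product|exact: tensopM|exact: adj_tensop].
- exists (@crossed_iso R _ H), (@diag_proj R _ (ell2 'I_n.+1 H)).
  exists (@diag_proj R _ H); split.
  + exact: crossed_iso_star_iso.
  + split=> [_ [a _ <-]|g]; first exact: crossed_iso_diagop.
    exact: crossed_iso_ltrans.
  + exact: crossed_product_expectation.
  + by apply: crossed_expectation_diag_proj => // X _; exact: imageT.
  + by move=> X _; exact: crossed_iso_diag_proj.
- move=> pi piE.
  have {piE}-> : pi = @diag_proj R _ H := crossed_expectation_unique erefl piE.
  split.
  + exact: diag_proj_opmx.
  + by move=> X g _; rewrite coefficient_ltrans; exact: imageT.
  + move=> X _; rewrite {1}[X]ltrans_expansion.
    by apply: eq_bigr => g _; rewrite coefficient_ltrans.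
  + move=> X Y g _ _; rewrite !coefficient_ltrans diagopM; congr diagop.
    by apply/funext => k; rewrite block_hadamard.
  + move=> x y; apply: block_inj => i j.
    by rewrite block_hadamard !block_opmx mxE.
Qed.
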